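(* Let $\Bbbk$ be a field of characteristic zero, let $\mathfrak M$ be a variety of algebras over $\Bbbk$ with bilinear operations $\circ_\omega$, $\omega\in\Omega$, let $A\in\mathfrak M$, and let $M$ be an $\mathfrak M$-bimodule over $A$. Let $m\ge1$ and let $Z=\mathrm{pre}\text{-}\mathrm{Com}\langle z_1,\dots,z_m\rangle$ be the free pre-commutative algebra on $z_1,\dots,z_m$. Then $$\mathrm{Var}\bigl(Z\boxtimes(A\rightthreetimes M)\bigr)=\mathrm{Var}(A\ltimes M).$$
   Context: $\mathrm{Var}(B)$ denotes the variety generated by an algebra $B$. An $\mathfrak M$-bimodule over $A\in\mathfrak M$ is a linear space $M$ with linear maps $r_\omega:M\otimes A\to M$, $l_\omega:A\otimes M\to M$, $\omega\in\Omega$, such that the split null extension $A\ltimes M$ belongs to $\mathfrak M$. Here $A\ltimes M$ is the space $A\oplus M$ with bilinear operations extending those of $A$ by $u\circ_\omega a=r_\omega(u,a)$, $a\circ_\omega u=l_\omega(a,u)$, $u\circ_\omega v=0$ for $a\in A$, $u,v\in M$. $A\rightthreetimes M$ is the space $A\oplus M$ with bilinear operations $\vdash_\omega,\dashv_\omega$, $\omega\in\Omega$, given for $a,b\in A$, $u,v\in M$ by $$a\vdash_\omega b=a\dashv_\omega b=a\circ_\omega b,\quad a\vdash_\omega u=l_\omega(a,u),\quad u\vdash_\omega a=0,$$ $$a\dashv_\omega u=0,\quad u\dashv_\omega a=r_\omega(u,a),\quad u\dashv_\omega v=u\vdash_\omega v=0.$$ $\mathrm{pre}\text{-}\mathrm{Com}$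 is the variety of algebras over $\Bbbk$ with one bilinear product satisfying $(xy+yx)z=x(yz)$. For $Z\in\mathrm{pre}\text{-}\mathrm{Com}$ and an algebra $D$ with operations $\vdash_\omega,\dashv_\omega$, $Z\boxtimes D$ is the space $Z\otimes D$ with operations $$(z\otimes a)\circ_\omega(w\otimes b)=zw\otimes(a\vdash_\omega b)+wz\otimes(a\dashv_\omega b),\quad z,w\in Z,\ a,b\in D.$$ *)

(* Defs.v *)
From HB Require Import structures.
From mathcomp Require Import all_boot all_order all_algebra.
From mathcomp Require Import boolp.

Set Implicit Arguments.
Unset Strict Implicit.
Unset Printing Implicit Defensive.

Import GRing.Theory.
Local Open Scope ring_scope.
Local Open Scope quotient_scope.

Record algebra (k : fieldType) (Omega : Type) := Algebra {
  alg_sort :> lmodType k;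
  aop : Omega -> {bilinear alg_sort -> alg_sort -> alg_sort}
}.

Definition is_hom (k : fieldType) (Omega : Type) (A B : algebra k Omega)
    (f : A -> B) : Prop :=
  linear f /\ forall w x y, f (aop A w x y) = aop B w (f x) (f y).

Inductive monomial (Omega X : Type) :=
| MVar of X
| MOp of Omega & monomial Omega X & monomial Omega X.

Fixpoint meval (k : fieldType) (Omega X : Type) (B : algebra k Omega)
    (x : X -> B) (u : monomial Omega X) : B :=
  match u with
  | MVar i => x i
  | MOp w u1 u2 => aop B w (meval x u1) (meval x u2)
  end.

(* An element of the free nonassociative Omega-algebra on X, written as a
   finite linear combination of monomials (a monomial may occur several times,
   so an element has many representations). *)
Definition nonassoc_poly (k : fieldType) (Omega X : Type) : Type :=
  seq (k * monomial Omega X).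

Definition peval (k : fieldType) (Omega X : Type) (B : algebra k Omega)
    (x : X -> B) (f : nonassoc_poly k Omega X) : B :=
  \sum_(t <- f) t.1 *: meval x t.2.

Definition satisfies (k : fieldType) (Omega : Type) (B : algebra k Omega)
    (f : nonassoc_poly k Omega nat) : Prop :=
  forall x : nat -> B, peval x f = 0.

Definition is_variety (k : fieldType) (Omega : Type)
    (V : algebra k Omega -> Prop) : Prop :=
  exists I : nonassoc_poly k Omega nat -> Prop,
    forall B, V B <-> (forall f, I f -> satisfies B f).

(* The variety generated by B: the intersection of all varieties containing B. *)
Definition Var (k : fieldType) (Omega : Type) (B : algebra k Omega) :
    algebra k Omega -> Prop :=
  fun C => forall V, is_variety V -> V B -> V C.

Section Bimodule.
Variables (k : fieldType) (Omega : Type) (A : algebra k Omega).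

(* The maps r_w and l_w with no axiom; [is_bimodule] below adds the condition
   on the split null extension. *)
Record biaction := Biaction {
  bim_sort :> lmodType k;
  ract : Omega -> {bilinear bim_sort -> A -> bim_sort};
  lact : Omega -> {bilinear A -> bim_sort -> bim_sort}
}.

Variable M : biaction.

Definition split_op (w : Omega) (x y : A * M) : A * M :=
  (aop A w x.1 y.1, ract M w x.2 y.1 + lact M w x.1 y.2).

Lemma split_op_bilinear w : bilinear_for *:%R *:%R (split_op w).
Proof.
split=> [y|x] c u v; rewrite /split_op; congr pair; rewrite /=.
- by rewrite linearPl.
- by rewrite !linearPl scalerDr addrACA.
- by rewrite linearPr.
- by rewrite !linearPr scalerDr addrACA.
Qed.
HB.instance Definition _ w :=
  bilinear_isBilinear.Build k _ _ _ *:%R *:%R (split_op w)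
    (split_op_bilinear w).

Definition split_null : algebra k Omega := Algebra split_op.

Definition is_bimodule (V : algebra k Omega -> Prop) : Prop := V split_null.

End Bimodule.

Record dialgebra (k : fieldType) (Omega : Type) := Dialgebra {
  dialg_sort :> lmodType k;
  vdop : Omega -> {bilinear dialg_sort -> dialg_sort -> dialg_sort}; (* a |- b *)
  dvop : Omega -> {bilinear dialg_sort -> dialg_sort -> dialg_sort}  (* a -| b *)
}.

Section Dirtimes.
Variables (k : fieldType) (Omega : Type) (A : algebra k Omega).
Variable M : biaction A.

Definition dirtimes_vd (w : Omega) (x y : A * M) : A * M :=
  (aop A w x.1 y.1, lact M w x.1 y.2).

Definition dirtimes_dv (w : Omega) (x y : A * M) : A * M :=
  (aop A w x.1 y.1, ract M w x.2 y.1).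

Lemma dirtimes_vd_bilinear w : bilinear_for *:%R *:%R (dirtimes_vd w).
Proof.
by split=> [y|x] c u v; rewrite /dirtimes_vd /= ?linearPl ?linearPr.
Qed.
HB.instance Definition _ w :=
  bilinear_isBilinear.Build k _ _ _ *:%R *:%R (dirtimes_vd w)
    (dirtimes_vd_bilinear w).

Lemma dirtimes_dv_bilinear w : bilinear_for *:%R *:%R (dirtimes_dv w).
Proof.
by split=> [y|x] c u v; rewrite /dirtimes_dv /= ?linearPl ?linearPr.
Qed.
HB.instance Definition _ w :=
  bilinear_isBilinear.Build k _ _ _ *:%R *:%R (dirtimes_dv w)
    (dirtimes_dv_bilinear w).

Definition dirtimes : dialgebra k Omega := Dialgebra dirtimes_vd dirtimes_dv.

End Dirtimes.

(* For a class P of maps from W to vector spaces, [univ P] is the vector space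
   carrying the universal map of P: formal linear combinations of elements of
   W, modulo the equalities that hold under every map in P. *)
Section Univ.
Variables (k : fieldType) (W : Type).
Variable P : forall V : lmodType k, (W -> V) -> Prop.

Let L := {classic (seq (k * W))}.

Definition fev (V : lmodType k) (f : W -> V) (s : seq (k * W)) : V :=
  \sum_(t <- s) t.1 *: f t.2.

Definition univ_eqv (s t : L) : bool :=
  `[< forall (V : lmodType k) (f : W -> V), P f -> fev f s = fev f t >].

Lemma univ_eqv_equiv : equiv_class_of univ_eqv.
Proof.
split=> [s|s t|t s u].
- exact/asboolP.
- by apply: asbool_equiv_eq; split=> h V f Pf; rewrite h.
- move=> /asboolP st /asboolP tu; apply/asboolP => V f Pf.
  by rewrite st // tu.
Qed.
Canonical univ_eqv_rel := EquivRelPack univ_eqv_equiv.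

Definition univ : Type := {eq_quot univ_eqv_rel}.
HB.instance Definition _ := Choice.on univ.
HB.instance Definition _ := EqQuotient.on univ.

Definition univ_pi (s : seq (k * W)) : univ := \pi_univ (s : L).
Definition univ_rep (x : univ) : seq (k * W) := repr x : L.

Lemma univ_eqP s t : univ_pi s = univ_pi t <->
  forall (V : lmodType k) (f : W -> V), P f -> fev f s = fev f t.
Proof.
rewrite /univ_pi; split=> [/eqmodP/asboolP //|h]; exact/eqmodP/asboolP.
Qed.

Lemma univ_repK x : univ_pi (univ_rep x) = x.
Proof. exact: reprK. Qed.

Lemma fev_rep (V : lmodType k) (f : W -> V) s :
  P f -> fev f (univ_rep (univ_pi s)) = fev f s.
Proof. by move=> Pf; have /univ_eqP -> := univ_repK (univ_pi s). Qed.

Definition fscale (c : k) (s : seq (k * W)) := [seq (c * t.1, t.2) | t <- s].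

Lemma fev_cat (V : lmodType k) (f : W -> V) s t :
  fev f (s ++ t) = fev f s + fev f t.
Proof. exact: big_cat. Qed.

Lemma fev_scale (V : lmodType k) (f : W -> V) c s :
  fev f (fscale c s) = c *: fev f s.
Proof.
by rewrite /fev big_map scaler_sumr; apply: eq_bigr => t _; rewrite scalerA.
Qed.

Lemma fev_nil (V : lmodType k) (f : W -> V) : fev f [::] = 0.
Proof. exact: big_nil. Qed.

Definition univ0 : univ := univ_pi [::].
Definition univ_add x y := univ_pi (univ_rep x ++ univ_rep y).
Definition univ_scale c x := univ_pi (fscale c (univ_rep x)).
Definition univ_opp x := univ_scale (-1) x.

Let fevE := (fev_cat, fev_scale, fev_nil).

Lemma univ_addA : associative univ_add.
Proof.
move=> x y z; apply/univ_eqP => V f Pf.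
by rewrite !fevE !fev_rep // !fevE addrA.
Qed.

Lemma univ_addC : commutative univ_add.
Proof. by move=> x y; apply/univ_eqP => V f Pf; rewrite !fevE addrC. Qed.

Lemma univ_add0 : left_id univ0 univ_add.
Proof.
move=> x; rewrite -[RHS]univ_repK; apply/univ_eqP => V f Pf.
by rewrite !fevE fev_rep // !fevE add0r.
Qed.

Lemma univ_addN : left_inverse univ0 univ_opp univ_add.
Proof.
move=> x; apply/univ_eqP => V f Pf.
by rewrite !fevE fev_rep // !fevE scaleN1r addNr.
Qed.

HB.instance Definition _ :=
  GRing.isZmodule.Build univ univ_addA univ_addC univ_add0 univ_addN.

Lemma univ_scaleA a b x : univ_scale a (univ_scale b x) = univ_scale (a * b) x.
Proof.
apply/univ_eqP => V f Pf.
by rewrite !fevE fev_rep // !fevE scalerA.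
Qed.

Lemma univ_scale1 : left_id 1 univ_scale.
Proof.
move=> x; rewrite -[RHS]univ_repK; apply/univ_eqP => V f Pf.
by rewrite !fevE scale1r.
Qed.

Lemma univ_scaleDr : right_distributive univ_scale +%R.
Proof.
move=> c x y; apply/univ_eqP => V f Pf.
by rewrite !fevE !fev_rep // !fevE scalerDr.
Qed.

Lemma univ_scaleDl x : {morph univ_scale^~ x : a b / a + b}.
Proof.
move=> a b; apply/univ_eqP => V f Pf.
by rewrite !fevE !fev_rep // !fevE scalerDl.
Qed.

HB.instance Definition _ := GRing.Zmodule_isLmodule.Build k univ
  univ_scaleA univ_scale1 univ_scaleDr univ_scaleDl.

Definition univ_gen (w : W) : univ := univ_pi [:: (1, w)].

Definition univ_lift (V : lmodType k) (f : W -> V) (x : univ) : V :=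
  fev f (univ_rep x).

Lemma univ_lift_linear (V : lmodType k) (f : W -> V) :
  P f -> linear (univ_lift f).
Proof.
by move=> Pf c x y; rewrite /univ_lift !(fev_rep, fevE).
Qed.

Lemma univ_lift_gen (V : lmodType k) (f : W -> V) w :
  P f -> univ_lift f (univ_gen w) = f w.
Proof.
by move=> Pf; rewrite /univ_lift fev_rep // /fev big_seq1 scale1r.
Qed.

Lemma univ_genE x : x = \sum_(t <- univ_rep x) t.1 *: univ_gen t.2.
Proof.
rewrite -[LHS]univ_repK; elim: (univ_rep x) => [|[c w] s IHs].
  by rewrite big_nil.
rewrite big_cons -IHs; apply/univ_eqP => V f Pf.
by rewrite !(fev_rep, fevE) // /fev !big_seq1 big_cons /= scale1r.
Qed.

Lemma univ_ext (V : lmodType k) (g h : univ -> V) :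
  linear g -> linear h -> (forall w, g (univ_gen w) = h (univ_gen w)) ->
  g =1 h.
Proof.
move=> lg lh gh x.
pose G := GRing.isLinear.Build _ _ _ _ g lg.
pose H := GRing.isLinear.Build _ _ _ _ h lh.
pose g' : {linear univ -> V} := HB.pack g G.
pose h' : {linear univ -> V} := HB.pack h H.
rewrite (univ_genE x) -[g _]/(g' _) -[h _]/(h' _) !linear_sum.
by apply: eq_bigr => t _; rewrite !linearZ /= gh.
Qed.

Lemma univ_gen_eq (s t : seq (k * W)) :
  (forall (V : lmodType k) (f : W -> V), P f -> fev f s = fev f t) ->
  fev univ_gen s = fev univ_gen t.
Proof.
move=> h; have E r : fev univ_gen r = univ_pi r.
  elim: r => [|[c w] r IHr]; first by rewrite fev_nil.
  rewrite /fev big_cons -/(fev _ r) IHr; apply/univ_eqP => V f Pf.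
  by rewrite !(fev_rep, fevE) // /fev !big_seq1 big_cons /= scale1r.
by rewrite !E; apply/univ_eqP.
Qed.

End Univ.

Section Tensor.
Variables (k : fieldType) (Z D : lmodType k).

(* Z (x) D is the target of the universal bilinear map: see [tens_bilinear],
   [tens_liftE] and [tens_ext]. *)
Definition is_bilinear (V : lmodType k) (f : Z * D -> V) : Prop :=
  (forall d, linear (fun z => f (z, d))) /\ (forall z, linear (fun d => f (z, d))).

Definition tensor : lmodType k := univ is_bilinear.

Definition tens (z : Z) (d : D) : tensor := univ_gen is_bilinear (z, d).

Lemma tens_bilinear : bilinear_for *:%R *:%R tens.
Proof.
split=> [d|z] c x y; rewrite /tens.
- have := @univ_gen_eq k _ is_bilinear [:: (1, (c *: x + y, d))]
           [:: (c, (x, d)); (1, (y, d))].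
  rewrite /fev big_seq1 big_cons big_seq1 /= !scale1r; apply=> V f [fl _].
  by rewrite big_seq1 big_cons big_seq1 /= !scale1r fl.
- have := @univ_gen_eq k _ is_bilinear [:: (1, (z, c *: x + y))]
           [:: (c, (z, x)); (1, (z, y))].
  rewrite /fev big_seq1 big_cons big_seq1 /= !scale1r; apply=> V f [_ fr].
  by rewrite big_seq1 big_cons big_seq1 /= !scale1r fr.
Qed.
HB.instance Definition _ :=
  bilinear_isBilinear.Build k _ _ _ *:%R *:%R tens tens_bilinear.

Definition tens_lift (V : lmodType k) (f : Z -> D -> V) : tensor -> V :=
  univ_lift (fun p => f p.1 p.2).

Lemma tens_lift_linear (V : lmodType k) (f : Z -> D -> V) :
  bilinear_for *:%R *:%R f -> linear (tens_lift f).
Proof. by case=> fl fr; exact: univ_lift_linear. Qed.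

Lemma tens_liftE (V : lmodType k) (f : Z -> D -> V) z d :
  bilinear_for *:%R *:%R f -> tens_lift f (tens z d) = f z d.
Proof. by case=> fl fr; rewrite /tens_lift univ_lift_gen. Qed.

Lemma tens_ext (V : lmodType k) (g h : tensor -> V) :
  linear g -> linear h -> (forall z d, g (tens z d) = h (tens z d)) -> g =1 h.
Proof. by move=> lg lh gh; apply: univ_ext => // -[z d]; apply: gh. Qed.

End Tensor.

Section Boxtimes.
Variables (k : fieldType) (Omega : Type).
Variables (Z : algebra k unit) (D : dialgebra k Omega).

Local Notation mul z z' := (aop Z tt z z').

Definition box_pure (w : Omega) (z : Z) (a : D) (z' : Z) (b : D) : tensor Z D :=
  tens (mul z z') (vdop D w a b) + tens (mul z' z) (dvop D w a b).

Definition box_op (w : Omega) (x y : tensor Z D) : tensor Z D :=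
  tens_lift (fun z a => tens_lift (box_pure w z a) y) x.

Lemma box_pure_bilinear_r w z a : bilinear_for *:%R *:%R (box_pure w z a).
Proof.
split=> [b|z'] c x y; rewrite /box_pure /=.
  by rewrite linearPr !linearPl scalerDr addrACA.
by rewrite !linearPr scalerDr addrACA.
Qed.

Lemma box_pure_bilinear_l w z' b :
  bilinear_for *:%R *:%R (fun z a => box_pure w z a z' b).
Proof.
split=> [a|z] c x y; rewrite /box_pure /=.
  by rewrite linearPr !linearPl scalerDr addrACA.
by rewrite !linearPl !linearPr scalerDr addrACA.
Qed.

Let lin_comb (V : lmodType k) (g h : tensor Z D -> V) c :
  linear g -> linear h -> linear (fun x => c *: g x + h x).
Proof.
move=> lg lh d x y; rewrite lg lh !scalerDr !scalerA mulrC -!addrA.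
by congr (_ + _); rewrite addrCA.
Qed.

Let box_inner_bilinear w y :
  bilinear_for *:%R *:%R (fun z a => tens_lift (box_pure w z a) y).
Proof.
have L z a := tens_lift_linear (box_pure_bilinear_r w z a).
split=> [a|z] c u v /=.
  apply: (tens_ext (L _ _) (lin_comb c (L _ _) (L _ _))) => z' b.
  rewrite !tens_liftE; try exact: box_pure_bilinear_r.
  exact: (box_pure_bilinear_l w z' b).1.
apply: (tens_ext (L _ _) (lin_comb c (L _ _) (L _ _))) => z' b.
rewrite !tens_liftE; try exact: box_pure_bilinear_r.
exact: (box_pure_bilinear_l w z' b).2.
Qed.

Lemma box_op_bilinear w : bilinear_for *:%R *:%R (box_op w).
Proof.
have L y := tens_lift_linear (box_inner_bilinear w y).
split=> [y|x] c u v; first exact: L.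
rewrite /box_op; apply: (tens_ext (L _) (lin_comb c (L _) (L _))) => z a.
rewrite !tens_liftE; try exact: box_inner_bilinear.
exact/tens_lift_linear/box_pure_bilinear_r.
Qed.
HB.instance Definition _ w :=
  bilinear_isBilinear.Build k _ _ _ *:%R *:%R (box_op w) (box_op_bilinear w).

Definition boxtimes : algebra k Omega := Algebra box_op.

(* Pure tensors span the tensor product, so this formula and bilinearity
   determine the operations. *)
Lemma boxtimesE w z a z' b :
  aop boxtimes w (tens z a) (tens z' b) =
  tens (mul z z') (vdop D w a b) + tens (mul z' z) (dvop D w a b).
Proof.
rewrite /= /box_op tens_liftE; last exact: box_inner_bilinear.
by rewrite tens_liftE //; exact: box_pure_bilinear_r.
Qed.

End Boxtimes.

(* A single operation: the index type is unit. *)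
Definition is_preCom (k : fieldType) (Z : algebra k unit) : Prop :=
  let mul (x y : Z) := aop Z tt x y in
  forall x y z : Z, mul (mul x y + mul y x) z = mul x (mul y z).

Definition is_free_preCom (k : fieldType) (m : nat) (Z : algebra k unit)
    (z : 'I_m -> Z) : Prop :=
  is_preCom Z /\
  forall B : algebra k unit, is_preCom B -> forall b : 'I_m -> B,
    exists f : Z -> B,
      [/\ is_hom f, (forall i, f (z i) = b i) &
          forall g : Z -> B, is_hom g -> (forall i, g (z i) = b i) -> g =1 f].

(* Existence of the algebra characterised by [is_free_preCom]: [freePreComP]. *)
Section FreeExists.
Variables (k : fieldType) (m : nat).

Local Notation mon := (monomial unit 'I_m).

Inductive preCom_eval : forall V : lmodType k, (mon -> V) -> Prop :=
  PreComEval (B : algebra k unit) (b : 'I_m -> B) of is_preCom B :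
    @preCom_eval B (meval b).

Definition free_sort : lmodType k := univ preCom_eval.

Definition fmul (s t : seq (k * mon)) : seq (k * mon) :=
  [seq (p.1 * q.1, MOp tt p.2 q.2) | p <- s, q <- t].

Lemma fev_mul (B : algebra k unit) (b : 'I_m -> B) s t :
  fev (meval b) (fmul s t) = aop B tt (fev (meval b) s) (fev (meval b) t).
Proof.
rewrite /fev /fmul big_allpairs_dep linear_sumlz.
apply: eq_bigr => p _; rewrite linear_sumr; apply: eq_bigr => q _ /=.
by rewrite linearZl_LR linearZr_LR scalerA.
Qed.

Definition free_op (x y : free_sort) : free_sort :=
  univ_pi preCom_eval (fmul (univ_rep x) (univ_rep y)).

Let fevE := (fev_mul, fev_cat, fev_scale, fev_nil).

Lemma free_addE (x y : free_sort) :
  x + y = univ_pi preCom_eval (univ_rep x ++ univ_rep y).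
Proof. by []. Qed.

Lemma free_scaleE c (x : free_sort) :
  c *: x = univ_pi preCom_eval (fscale c (univ_rep x)).
Proof. by []. Qed.

Lemma free_op_bilinear : bilinear_for *:%R *:%R free_op.
Proof.
split=> [y|x] c u v; rewrite /free_op !(free_addE, free_scaleE).
  apply/univ_eqP => V f Pf; rewrite !(fev_cat, fev_scale, fev_rep) //.
  by case: V f / Pf => B b hB; rewrite !(fev_rep, fevE) // linearPl.
apply/univ_eqP => V f Pf; rewrite !(fev_cat, fev_scale, fev_rep) //.
by case: V f / Pf => B b hB; rewrite !(fev_rep, fevE) // linearPr.
Qed.
HB.instance Definition _ :=
  bilinear_isBilinear.Build k _ _ _ *:%R *:%R free_op free_op_bilinear.

Definition freePreCom : algebra k unit := Algebra (fun=> free_op).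
Definition free_var (i : 'I_m) : freePreCom :=
  univ_gen preCom_eval (MVar unit i).

Lemma freePreCom_preCom : is_preCom freePreCom.
Proof.
move=> /= x y z; rewrite /free_op free_addE; apply/univ_eqP => V f Pf.
case: V f / Pf => B b hB; rewrite !fevE.
by rewrite !(fev_rep, fevE) //; apply: hB.
Qed.

Lemma free_op_gen u v :
  free_op (univ_gen preCom_eval u) (univ_gen preCom_eval v) =
  univ_gen preCom_eval (MOp tt u v).
Proof.
apply/univ_eqP => V f [B b hB].
by rewrite fev_mul !fev_rep // /fev !big_seq1 /= !scale1r.
Qed.

Theorem freePreComP : is_free_preCom free_var.
Proof.
split=> [|B hB b]; first exact: freePreCom_preCom.
have Pb : preCom_eval (meval b) by [].
exists (univ_lift (meval b)); split.
- split=> [|[] x y]; first exact: univ_lift_linear.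
  by rewrite /univ_lift /= fev_rep // fev_mul.
- by move=> i; rewrite univ_lift_gen.
move=> g [lg hg] gb; apply: univ_ext => // [|u]; first exact: univ_lift_linear.
rewrite univ_lift_gen //; elim: u => [i|[] u IHu v IHv] /=; first exact: gb.
by rewrite -IHu -IHv -hg /= free_op_gen.
Qed.

End FreeExists.

(* Main.v *)
(* It suffices that the two algebras satisfy the same identities.

   In a pre-commutative algebra Z the product {z, w} = zw + wz is commutative
   and associative, and left multiplication makes Z a module over the algebra
   Z+ = (Z, {,}).  Hence the box product is a subalgebra of the extension of
   scalars of the split null extension B by the commutative algebra Z+ (+) Z,
   where Z has zero product.  Over a field of characteristic zero, identities
   of B survive extension of scalars, because each multihomogeneous component
   of a polynomial map vanishes when all its values do.  Multidegrees are coded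
   here as integers, the i-th variable having the i-th prime as weight;
   multiplying each variable by the j-th power of its prime, for all j,
   isolates each component by interpolation.

   Conversely, let every generator of Z go to the indeterminate t of t k[t], a
   pre-commutative algebra under the primitive of x y' vanishing at 0.  Mapping
   the tensor product of z and a + u to x(1) a + x'(1) u, where x is the image
   of z, is a homomorphism onto B. *)
From HB Require Import structures.
Require Import Defs.
From mathcomp Require Import all_boot all_order all_algebra.
From mathcomp Require Import boolp.

Set Implicit Arguments.
Unset Strict Implicit.
Unset Printing Implicit Defensive.

Import GRing.Theory.
Local Open Scope ring_scope.

(** * Interpolation in characteristic zero *)

Lemma natr_inj_pchar0 (k : fieldType) :
  [pchar k] =i pred0 -> injective (fun n : nat => n%:R : k).
Proof.
move=> /pcharf0P hk; suff W m n : (m <= n)%N -> m%:R = n%:R :> k -> m = n.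
  move=> m n emn; have [/W->//|/ltnW/W->//] := leqP m n; exact: esym.
move=> le_mn /esym/eqP; rewrite -subr_eq0 -natrB // hk subn_eq0 => le_nm.
by apply/eqP; rewrite eqn_leq le_mn.
Qed.

(* Lagrange interpolation at the distinct nodes [t.1%:R]. *)
Lemma sum_moments_eq0 (k : fieldType) (B W : lmodType k)
    (L : seq (nat * B)) (h : nat -> {linear B -> W}) :
  [pchar k] =i pred0 ->
  (forall j, \sum_(t <- L) (t.1%:R ^+ j : k) *: t.2 = 0) ->
  \sum_(t <- L) h t.1 t.2 = 0.
Proof.
move=> hk hL.
have hP (p : {poly k}) : \sum_(t <- L) p.[t.1%:R] *: t.2 = 0.
  under eq_bigr do rewrite horner_coef scaler_suml.
  rewrite exchange_big big1 //= => j _.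
  by under eq_bigr do rewrite -scalerA; rewrite -scaler_sumr hL scaler0.
pose nodes := undup [seq t.1 | t <- L].
pose P n : {poly k} := \prod_(i <- nodes | i != n) ('X - (i%:R)%:P).
pose c n : k := (P n).[n%:R].
have cE n : c n = \prod_(i <- nodes | i != n) (n%:R - i%:R).
  by rewrite /c /P horner_prod; apply: eq_bigr => i _; rewrite hornerXsubC.
have c0 n : c n != 0.
  rewrite cE prodf_seq_neq0; apply/allP => i _; apply/implyP.
  rewrite subr_eq0; apply: contra => /eqP e.
  by apply/eqP; exact/esym/(natr_inj_pchar0 hk).
have Pn0 m n : m \in nodes -> m != n -> (P n).[m%:R] = 0.
  move=> mL mn; rewrite /P horner_prod (big_rem m) //= mn hornerXsubC subrr.
  by rewrite mul0r.
(* [P n] vanishes at every node except [n], so only [n = t.1] survives in the inner sum. *)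
transitivity (\sum_(t <- L) \sum_(n <- nodes)
    h n (((c n)^-1 * (P n).[t.1%:R]) *: t.2)).
  rewrite !big_seq; apply: eq_bigr => t tL.
  have tn : t.1 \in nodes by rewrite mem_undup map_f.
  rewrite (bigD1_seq t.1) ?undup_uniq //= -/(c _) mulVf // scale1r.
  rewrite big_seq_cond big1 ?addr0 // => n /andP[nn nt].
  by rewrite Pn0 1?eq_sym // mulr0 scale0r raddf0.
rewrite exchange_big big1 //= => n _; rewrite -raddf_sum.
under eq_bigr do rewrite -scalerA.
by rewrite -scaler_sumr hP scaler0 raddf0.
Qed.

(** * Integer codes of multidegrees *)

Fixpoint primeseq (n : nat) : nat :=
  if n is n'.+1 then s2val (prime_above (primeseq n')) else 2%N.

Lemma prime_primeseq n : prime (primeseq n).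
Proof. by case: n => //= n; case: prime_above. Qed.

Lemma primeseq_inj : injective primeseq.
Proof.
have lt_q: {homo primeseq : m n / (m < n)%N}.
  by apply: (homo_ltn ltn_trans) => n /=; case: prime_above.
move=> m n; have [/lt_q+ e|/lt_q+ e|//] := ltngtP m n; by rewrite e ltnn.
Qed.

(* The values of a multiplicative map may be prescribed freely at primes, the
   positive integers being the free commutative monoid on the primes; [None]
   is the unit adjoined to [E]. *)
Lemma multiplicative_decoding (E : Type) (op : E -> E -> E)
    (opA : associative op) (opC : commutative op) (T : countType) (e : T -> E) :
  exists phi : nat -> option E,
    (forall m n, (0 < m)%N -> (0 < n)%N ->
       phi (m * n)%N = oAC opA opC (phi m) (phi n)) /\
    forall t, phi (primeseq (pickle t)) = Some (e t).
Proof.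
pose q (t : T) := primeseq (pickle t).
have q_inj : injective q.
  exact: inj_comp primeseq_inj (pcan_inj pickleK).
pose g p : option E :=
  if pselect (exists t, q t = p) is left h then Some (e (projT1 (cid h)))
  else None.
have gq t : g (q t) = Some (e t).
  rewrite /g; case: pselect => [h|[]]; last by exists t.
  by case: cid => s /= /q_inj ->.
pose oop := oAC opA opC.
(* Only primes contribute, and none above [n] divides [n], so every bound [N > n] gives the same
   value. *)
pose phiN N n : option E :=
  \big[oop/None]_(0 <= p < N) \big[oop/None]_(0 <= i < logn p n) g p.
have phiW N n : (n.+1 <= N)%N -> phiN N n = phiN n.+1 n.
  move=> le_nN; rewrite /phiN (@big_cat_nat _ _ _ n.+1) //=.
  have -> : \big[oop/None]_(n.+1 <= p < N)
      \big[oop/None]_(0 <= i < logn p n) g p = None.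
    rewrite big_nat; apply: big1 => p /andP[np _].
    by rewrite ltn_log0 // big_geq.
  exact: Monoid.mulm1.
exists (fun n => phiN n.+1 n); split=> [m n m0 n0|t].
  rewrite -(phiW (m * n).+1 m) ?ltnS ?leq_pmulr //.
  rewrite -(phiW (m * n).+1 n) ?ltnS ?leq_pmull //.
  rewrite /phiN -[RHS]big_split; apply: eq_bigr => p _.
  rewrite lognM // (@big_cat_nat _ _ _ (logn p m)) ?leq_addr //=.
  by congr (oop _ _); rewrite -{1}[logn p m]add0n big_addn addKn.
have pq := prime_primeseq (pickle t).
rewrite /phiN big_nat_recr //= logn_prime // eqxx big_nat1 -/(q t) gq.
rewrite big_nat big1 ?Monoid.mul1m // => p /andP[_ lt_pq].
by rewrite logn_prime // ltn_eqF // big_geq.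
Qed.

(** * Multilinear expansion and weights of monomials *)

Fixpoint expand (Omega X T : Type) (P : X -> seq T) (u : monomial Omega X) :
    seq (monomial Omega T) :=
  match u with
  | MVar i => [seq MVar Omega p | p <- P i]
  | MOp w u1 u2 => [seq MOp w v1 v2 | v1 <- expand P u1, v2 <- expand P u2]
  end.

Lemma meval_sum (k : fieldType) (Omega X T : Type) (B : algebra k Omega)
    (P : X -> seq T) (l : T -> B) (x : X -> B) (u : monomial Omega X) :
  (forall i, x i = \sum_(p <- P i) l p) ->
  meval x u = \sum_(v <- expand P u) meval l v.
Proof.
move=> xE; elim: u => [i|w u1 IH1 u2 IH2] /=; first by rewrite big_map xE.
rewrite big_allpairs_dep IH1 IH2 linear_sumlz; apply: eq_bigr => v1 _.
exact: linear_sumr.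
Qed.

Fixpoint weight (Omega T : Type) (q : T -> nat) (v : monomial Omega T) : nat :=
  match v with
  | MVar p => q p
  | MOp _ v1 v2 => weight q v1 * weight q v2
  end.

Lemma weight_gt0 (Omega T : Type) (q : T -> nat) (v : monomial Omega T) :
  (forall p, 0 < q p)%N -> (0 < weight q v)%N.
Proof. by move=> q0; elim: v => //= w v1 IH1 v2 IH2; rewrite muln_gt0 IH1. Qed.

Lemma meval_scale (k : fieldType) (Omega T : Type) (B : algebra k Omega)
    (q : T -> nat) (b : T -> B) j (v : monomial Omega T) :
  meval (fun p => (q p)%:R ^+ j *: b p) v = (weight q v)%:R ^+ j *: meval b v.
Proof.
elim: v => //= w v1 -> v2 ->.
by rewrite linearZl_LR linearZr_LR scalerA natrM exprMn.
Qed.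

(** * From identities of the split null extension to the box product *)

Section SplitToBox.
Variables (k : fieldType) (Omega : Type) (A : algebra k Omega) (M : biaction A).
Variables (Z : algebra k unit) (hZ : is_preCom Z).

Local Notation B := (split_null M).
Local Notation D := (dirtimes M).
Local Notation Box := (boxtimes Z D).
Local Notation mul z w := (aop Z tt z w).

Definition symmul (z w : Z) : Z := mul z w + mul w z.

Lemma symmulC : commutative symmul.
Proof. by move=> z w; rewrite /symmul addrC. Qed.

Lemma mul_symmul x y z : mul (symmul x y) z = mul x (mul y z).
Proof. exact: hZ. Qed.

Lemma mul_left_comm x y z : mul x (mul y z) = mul y (mul x z).
Proof. by rewrite -!mul_symmul symmulC. Qed.

(** Up to left commutativity, both sides are [x(yz) + x(zy) + y(zx)]. *)
Lemma symmulA : associative symmul.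
Proof.
move=> x y z; rewrite {1 3}/symmul !mul_symmul /symmul !linearDr /= -addrA.
by rewrite (mul_left_comm z x) (mul_left_comm z y) [X in _ + X]addrC.
Qed.

(* [Z * Z] stands for the null extension of the commutative algebra
   [(Z, symmul)] by its module [Z], on which it acts by left multiplication. *)
Definition extmul (r s : Z * Z) : Z * Z :=
  (symmul r.1 s.1, mul r.1 s.2 + mul s.1 r.2).

Lemma extmulC : commutative extmul.
Proof. by move=> r s; rewrite /extmul symmulC addrC. Qed.

Lemma extmulA : associative extmul.
Proof.
move=> r s t; rewrite /extmul /= symmulA !mul_symmul !linearDr /= addrA.
by rewrite (mul_left_comm t.1 r.1) (mul_left_comm t.1 s.1).
Qed.

(* The restriction to homogeneous pairs (see [homog]) of the identification of
   [Z (x) D] with a subspace of [(Z * Z) (x) B]. *)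
Definition embed (r : option (Z * Z)) (b : B) : Box :=
  if r is Some (z, w) then tens z ((b.1, 0) : D) + tens w ((0, b.2) : D) else 0.

Lemma embed_linear r : linear (embed r).
Proof.
case: r => [[z w]|] c u v /=; last by rewrite scaler0 addr0.
have -> : ((c *: u.1 + v.1, 0) : D) = c *: ((u.1, 0) : D) + ((v.1, 0) : D).
  by congr pair; rewrite /= scaler0 addr0.
have -> : ((0, c *: u.2 + v.2) : D) = c *: ((0, u.2) : D) + ((0, v.2) : D).
  by congr pair; rewrite /= scaler0 addr0.
by rewrite !linearPr /= scalerDr addrACA.
Qed.
HB.instance Definition _ r :=
  GRing.isLinear.Build k B Box _ (embed r) (embed_linear r).

(** Equal parity for the gradings by Z/2 whose odd parts are the second factors. *)
Definition homog (r : Z * Z) (b : B) : Prop :=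
  r.2 = 0 /\ b.2 = 0 \/ r.1 = 0 /\ b.1 = 0.

Lemma homog_mul w r s b c :
  homog r b -> homog s c -> homog (extmul r s) (aop B w b c).
Proof.
case: r s b c => [r1 r2] [s1 s2] [b1 b2] [c1 c2].
rewrite /homog /extmul /symmul /= /split_op /=.
by case=> -[-> ->] [] [-> ->]; rewrite !(linear0l, linear0r) /= ?addr0; auto.
Qed.

(** For two even factors the two box terms add up to [symmul]; for mixed parity only the term acting
    on [M] survives; two odd factors give 0 on both sides. *)
Lemma embed_mul w r s b c : homog r b -> homog s c ->
  embed (Some (extmul r s)) (aop B w b c) =
  aop Box w (embed (Some r) b) (embed (Some s) c).
Proof.
case: r s b c => [r1 r2] [s1 s2] [b1 b2] [c1 c2].
have t0 z : tens z ((0, 0) : D) = 0 by exact: linear0r.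
have tl d : tens 0 d = 0 :> Box by exact: linear0l.
rewrite /homog /embed /=.
case=> -[-> ->] [] [-> ->]; rewrite /extmul /symmul /= !(t0, tl, addr0, add0r);
  rewrite boxtimesE /= /split_op /dirtimes_vd /dirtimes_dv /=;
  by rewrite !(linear0l, linear0r) /= ?(t0, tl, addr0, add0r) // linearDl.
Qed.

Lemma box_homog_decomposition (y : Box) : exists s : seq ((Z * Z) * B),
  y = \sum_(t <- s) embed (Some t.1) t.2 /\
  forall j, homog (nth 0 s j).1 (nth 0 s j).2.
Proof.
rewrite (univ_genE y); elim: (univ_rep y) => [|[c [z d]] r [s [sE sh]]].
  by exists [::]; rewrite !big_nil; split=> // j; rewrite nth_nil; left.
(* A pure tensor splits along the [A] and [M] parts of [d]. *)
exists [:: ((c *: z, 0), (d.1, 0)), ((0, c *: z), (0, d.2)) & s]; split.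
  rewrite !big_cons sE /= addrA; congr (_ + _).
  have t0 z' : tens z' ((0, 0) : D) = 0 by exact: linear0r.
  have tl d' : tens 0 d' = 0 :> Box by exact: linear0l.
  rewrite !(t0, tl, addr0, add0r) -[univ_gen _ _]/(tens z d) -linearDr /=.
  rewrite linearZl_LR; congr (_ *: tens _ _).
  by rewrite [LHS]surjective_pairing; congr pair; rewrite /= ?addr0 ?add0r.
by case=> [|[|j]] /=; [left | right | exact: sh].
Qed.

Lemma satisfies_split_box (hk : [pchar k] =i pred0)
    (f : nonassoc_poly k Omega nat) :
  satisfies B f -> satisfies Box f.
Proof.
move=> hf x; have /choice[R hR] := fun i => box_homog_decomposition (x i).
(* The variable [(i, j)] stands for the [j]-th homogeneous summand of [x i]. *)
pose P i := [seq (i, j) | j <- iota 0 (size (R i))].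
pose dat (p : nat * nat) := nth 0 (R p.1) p.2.
pose e p := (dat p).1; pose b p := (dat p).2.
pose q (p : nat * nat) := primeseq (pickle p).
have [phi [phiM phiq]] := multiplicative_decoding extmulA extmulC e.
have q0 p : (0 < q p)%N by apply: prime_gt0; apply: prime_primeseq.
pose l p := embed (phi (q p)) (b p).
have xE i : x i = \sum_(p <- P i) l p.
  rewrite (hR i).1 big_map (big_nth 0) /index_iota subn0.
  by apply: eq_bigr => j _; rewrite /l phiq.
(* The weight alone determines the factor [r], so monomials of equal weight share one linear map
   [embed]. *)
have lE v : exists r, [/\ phi (weight q v) = Some r, homog r (meval b v) &
    meval l v = embed (Some r) (meval b v)].
  elim: v => [p|w v1 [r1 [e1 h1 E1]] v2 [r2 [e2 h2 E2]]] /=.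
    by exists (e p); split; rewrite ?/l ?phiq //; apply: (hR _).2.
  exists (extmul r1 r2); split; last by rewrite E1 E2; exact/esym/embed_mul.
    by rewrite phiM ?weight_gt0 // e1 e2.
  exact: homog_mul.
pose L := flatten [seq [seq (weight q v, t.1 *: meval b v)
                       | v <- expand P t.2] | t <- f].
have LE (V : lmodType k) (F : nat * B -> V) : \sum_(y <- L) F y =
    \sum_(t <- f) \sum_(v <- expand P t.2) F (weight q v, t.1 *: meval b v).
  by rewrite big_flatten big_map; apply: eq_bigr => t _; rewrite big_map.
have <- : \sum_(y <- L) embed (phi y.1) y.2 = peval x f.
  rewrite LE; apply: eq_bigr => t _; rewrite (meval_sum _ xE) scaler_sumr.
  apply: eq_bigr => v _; rewrite linearZ /=.
  by have [r [-> _ ->]] := lE v.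
pose h n : {linear B -> Box} := embed (phi n).
apply: (@sum_moments_eq0 _ _ _ L h) => // j.
(* The [j]-th moment is a value of [f] in [B], hence zero. *)
rewrite LE -[RHS](hf (fun i => \sum_(p <- P i) (q p)%:R ^+ j *: b p)).
apply: eq_bigr => t _.
rewrite (meval_sum (P := P) (l := fun p => (q p)%:R ^+ j *: b p)) //.
rewrite scaler_sumr; apply: eq_bigr => v _.
by rewrite meval_scale !scalerA mulrC.
Qed.

End SplitToBox.

(** * From identities of the box product to the split null extension *)

Section BoxToSplit.
Variables (k : fieldType) (hk : [pchar k] =i pred0).

Let natr_neq0 n : n.+1%:R != 0 :> k.
Proof. by move/pcharf0P: hk => ->. Qed.

Definition integ (p : {poly k}) : {poly k} :=
  \poly_(i < (size p).+1) (p`_i.-1 / i%:R).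

(* The coefficient at [i = 0] is correct because [x / 0 = 0]. *)
Lemma coef_integ p i : (integ p)`_i = p`_i.-1 / i%:R.
Proof.
rewrite coef_poly; case: ltnP => // lt_pi.
by case: i lt_pi => //= i lt_pi; rewrite nth_default ?mul0r.
Qed.

Lemma integ_linear : linear integ.
Proof.
move=> c p q; apply/polyP => i.
by rewrite !(coefD, coefZ, coef_integ) mulrDl mulrA.
Qed.
HB.instance Definition _ :=
  GRing.isLinear.Build k {poly k} {poly k} _ integ integ_linear.

Lemma deriv_integ p : (integ p)^`() = p.
Proof.
by apply/polyP => i; rewrite coef_deriv coef_integ /= -[LHS]mulr_natr mulfVK.
Qed.

Lemma integ_coef0 p : (integ p)`_0 = 0.
Proof. by rewrite coef_integ invr0 mulr0. Qed.

Lemma deriv_coef0_inj (p q : {poly k}) : p^`() = q^`() -> p`_0 = q`_0 -> p = q.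
Proof.
move=> /polyP d e0; apply/polyP => -[//|i]; move/(_ i): d.
rewrite !coef_deriv -[RHS]mulr_natr -[LHS]mulr_natr; exact: mulIf.
Qed.

Definition integ_mul (p q : {poly k}) : {poly k} := integ p * q.

Lemma integ_mul_bilinear : bilinear_for *:%R *:%R integ_mul.
Proof.
split=> [q|p] c u v; rewrite /integ_mul /=.
  by rewrite linearP mulrDl scalerAl.
by rewrite mulrDr scalerAr.
Qed.
HB.instance Definition _ :=
  bilinear_isBilinear.Build k _ _ _ *:%R *:%R integ_mul integ_mul_bilinear.

(* The algebra of polynomials without constant term, the product of [x] and [y]
   being the primitive of [x y'] that vanishes at 0; each polynomial is
   represented by its derivative. *)
Definition integ_alg : algebra k unit := Algebra (fun=> integ_mul).

(** Integration by parts. *)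
Lemma integ_symmul p q :
  integ (integ_mul p q + integ_mul q p) = integ p * integ q.
Proof.
apply: deriv_coef0_inj.
  by rewrite deriv_integ derivM !deriv_integ /integ_mul addrC [p * _]mulrC.
by rewrite integ_coef0 coef0M integ_coef0 mul0r.
Qed.

Lemma integ_preCom : is_preCom integ_alg.
Proof. by move=> p q r; rewrite /= /integ_mul integ_symmul mulrA. Qed.

Lemma hom_peval (Omega : Type) (B C : algebra k Omega) (F : B -> C)
    (x : nat -> B) (f : nonassoc_poly k Omega nat) :
  is_hom F -> F (peval x f) = peval (F \o x) f.
Proof.
move=> [lF FM].
pose F' : {linear B -> C} := HB.pack F (GRing.isLinear.Build _ _ _ _ F lF).
rewrite /peval -[F]/(F' : B -> C) linear_sum; apply: eq_bigr => t _.
rewrite linearZ; congr (_ *: _).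
by elim: t.2 => //= w u IHu v IHv; rewrite FM IHu IHv.
Qed.

Variables (Omega : Type) (A : algebra k Omega) (M : biaction A).
Variables (m : nat) (hm : (1 <= m)%N).
Variables (Z : algebra k unit) (z : 'I_m -> Z) (hZ : is_free_preCom z).

Local Notation B := (split_null M).
Local Notation D := (dirtimes M).
Local Notation Box := (boxtimes Z D).
Local Notation mul z w := (aop Z tt z w).

(* [alpha] is [x(1)] and [mu] is [x'(1)] for the image [x] of an element of [Z]
   in the polynomials without constant term, every [z i] going to the
   indeterminate. *)
Lemma exists_module_characters : exists alpha mu : Z -> k,
  [/\ linear (alpha : Z -> k^o), linear (mu : Z -> k^o),
      forall v w, alpha (mul v w + mul w v) = alpha v * alpha w,
      forall v w, mu (mul v w) = alpha v * mu w &
      exists z0, alpha z0 = 1 /\ mu z0 = 1].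
Proof.
(* The constant 1 is the derivative of the indeterminate. *)
have [_ /(_ integ_alg integ_preCom (fun=> 1))[g [[gl gM] gz _]]] := hZ.
exists (fun v => (integ (g v)).[1]), (fun v => (g v).[1]); split.
- by move=> c v w; rewrite gl linearP hornerD hornerZ.
- by move=> c v w; rewrite gl hornerD hornerZ.
- move=> v w; have -> : g (mul v w + mul w v) = g (mul v w) + g (mul w v).
    by have := gl 1 (mul v w) (mul w v); rewrite !scale1r.
  by rewrite !gM integ_symmul hornerM.
- by move=> v w; rewrite gM hornerM.
exists (z (Ordinal hm)); rewrite gz; split; last by rewrite hornerC.
suff -> : integ 1 = 'X by rewrite hornerX.
apply: deriv_coef0_inj; first by rewrite deriv_integ derivX.
by rewrite integ_coef0 coefX.
Qed.

Lemma exists_hom_box_split :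
  exists F : Box -> B, is_hom F /\ forall b, exists y, F y = b.
Proof.
have [alpha [mu [al ml aM mM [z0 [a0 m0]]]]] := exists_module_characters.
pose G (v : Z) (d : D) : B := (alpha v *: d.1, mu v *: d.2).
have Gb : bilinear_for *:%R *:%R G.
  split=> [d|v] c x y; congr pair; rewrite /= ?al ?ml ?scalerDl ?scalerA //.
  - by rewrite scalerDr scalerA mulrC -scalerA.
  - by rewrite scalerDr scalerA mulrC -scalerA.
pose F := tens_lift G; have Fl : linear F := tens_lift_linear Gb.
have FE v d : F (tens v d) = G v d by exact: tens_liftE.
exists F; split; last first.
  by case=> a u; exists (tens z0 ((a, u) : D)); rewrite FE /G a0 m0 !scale1r.
split=> // w x y.
have FD u v : F (u + v) = F u + F v by have := Fl 1 u v; rewrite !scale1r.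
have linl y' : linear (fun x' => F (aop Box w x' y')).
  by move=> c u v; rewrite linearPl Fl.
have linr x' : linear (fun y' => F (aop Box w x' y')).
  by move=> c u v; rewrite linearPr Fl.
have linl' y' : linear (fun x' => aop B w (F x') (F y')).
  by move=> c u v; rewrite Fl linearPl.
have linr' x' : linear (fun y' => aop B w (F x') (F y')).
  by move=> c u v; rewrite Fl linearPr.
apply: (tens_ext (linl y) (linl' y)) => v a.
apply: (tens_ext (linr _) (linr' _)) => v' b.
have aD : alpha (mul v v') + alpha (mul v' v) = alpha v * alpha v'.
  by rewrite -aM; have := al 1 (mul v v') (mul v' v); rewrite !scale1r => ->.
rewrite boxtimesE FD !FE /= /split_op /G /=.
(* In [A] both box terms carry the same product, so their coefficients add up; in [M] each term
   matches one action. *)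
congr pair; rewrite /= !linearZl_LR !linearZr_LR !scalerA.
  by rewrite -scalerDl aD.
by rewrite !mM addrC [alpha v' * _]mulrC.
Qed.

(** Identities pass to homomorphic images. *)
Lemma satisfies_box_split (f : nonassoc_poly k Omega nat) :
  satisfies Box f -> satisfies B f.
Proof.
have [F [Fh Fs]] := exists_hom_box_split.
move=> hf x; have /choice[y yE] := fun i => Fs (x i).
rewrite (_ : x = F \o y); last by apply/funext => i; rewrite /= yE.
rewrite -(hom_peval _ _ Fh) hf.
by have := Fh.1 (-1) 0 0; rewrite scaler0 addr0 scaleN1r addNr.
Qed.

End BoxToSplit.

(** Varieties are cut out by identities, so each one containing [B] contains [C]. *)
Lemma Var_incl (k : fieldType) (Omega : Type) (B C : algebra k Omega) :
  (forall f, satisfies B f -> satisfies C f) ->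
  forall E, Var C E -> Var B E.
Proof.
move=> BC E CE W [I hI] WB; apply: CE; first by exists I.
by apply/hI => f If; apply: BC; move/hI: WB; apply.
Qed.

Theorem proposition1 (k : fieldType) (hk : [pchar k] =i pred0) (Omega : Type)
  (V : algebra k Omega -> Prop) (hV : is_variety V)
  (A : algebra k Omega) (hA : V A)
  (M : biaction A) (hM : is_bimodule M V)
  (m : nat) (hm : (1 <= m)%N)
  (Z : algebra k unit) (z : 'I_m -> Z) (hZ : is_free_preCom z) :
  forall C : algebra k Omega,
    Var (boxtimes Z (dirtimes M)) C <-> Var (split_null M) C.
Proof.
move=> C; split; apply: Var_incl.
  exact: (satisfies_split_box hZ.1 hk).
exact: (satisfies_box_split hk hm hZ).
Qed.
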